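(* Let $C,D\subseteq\mathbb{R}^n$, $F,G:\mathbb{R}^n\rightrightarrows\mathbb{R}^n$ define the hybrid system $\dot x\in F(x)$, $x\in C$; $x^+\in G(x)$, $x\in D$, satisfying the hybrid basic conditions (A1)–(A3) below, and let $\phi^\star$ be a $t$-complete solution of this system. Assume: (i) $G(D)\cap D=\emptyset$, $G(D)\subseteq C$, and $G$ is single-valued and proper; (ii) for all $x\in C\cap D$, $F(x)\cap T_C(x)=\emptyset$; (iii) for all $x\in C\cap G(D)$, $-F(x)\cap T_C(x)=\emptyset$; (iv) either $D$ is bounded or $\phi^\star$ is bounded. Then for every $\varepsilon>0$ there exists $s>0$ such that for any $t$-complete solution $\phi$ of the system satisfying (v) $\|\phi^\star(0,0)-\phi(0,0)\|<s$, and (vi) for all $(t,j)\in\operatorname{dom}\phi^\star$ there exists $(t,\tilde\jmath)\in\operatorname{dom}\phi$ with $\rho_{\mathcal A}(\phi^\star(t,j),\phi(t,\tilde\jmath))<s$, it holds that for every $(t,j)\in\operatorname{dom}\phi^\star$ there exists $(t',j')\in\operatorname{dom}\phi$ with $|t-t'|<\varepsilon$ and $\|\phi^\star(t,j)-\phi(t',j')\|<\varepsilon$.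
   Context: $\|\cdot\|$ is the Euclidean norm, $\mathcal B_s=\{x:\|x\|\le s\}$, $S_1+S_2=\{y_1+y_2:y_1\in S_1,y_2\in S_2\}$, $\operatorname{dom}F=\{x:F(x)\neq\emptyset\}$. Hybrid basic conditions: (A1) $C$ and $D$ are closed; (A2) $F$ is outer semicontinuous and locally bounded relative to $C$, $C\subseteq\operatorname{dom}F$, and $F(x)$ is convex for each $x\in C$; (A3) $G$ is outer semicontinuous and locally bounded relative to $D$, and $D\subseteq\operatorname{dom}G$. A hybrid time domain is a set $E\subseteq\mathbb{R}_{\ge0}\times\mathbb{N}$ such that for each $(T,J)\in E$, $E\cap([0,T]\times\{0,\dots,J\})=\bigcup_{j=0}^{J}[t_j,t_{j+1}]\times\{j\}$ for some $0=t_0\le t_1\le\dots\le t_{J+1}$. A solution is a function $\phi$ on a hybrid time domain with $t\mapsto\phi(t,j)$ locally absolutely continuous on each $I^j=\{t:(t,j)\in\operatorname{dom}\phi\}$, $\phi(0,0)\in C\cup D$, such that for each $j$ with $I^j$ of nonempty interior, $\phi(t,j)\in C$ for all $t\in\operatorname{int}I^j$ and $\frac{d}{dt}\phi(t,j)\in F(\phi(t,j))$ for almost all $t\in I^j$, and whenever $(t,j),(t,j+1)\in\operatorname{dom}\phi$, $\phi(t,j)\in D$ and $\phi(t,j+1)\in G(\phi(t,j))$. A solution is $t$-complete if $\sup_{(t,j)\in\operatorname{dom}\phi}t=\infty$, and bounded if $\|\phi(t,j)\|\le R$ on its domain for some $R>0$. $T_C(x)$ is the (Bouligand) tangent cone: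 the set of $w$ for which there exist $\tau_i\downarrow0$ and $w_i\to w$ with $x+\tau_iw_i\in C$. $G$ proper means preimages of compact sets are compact. $\mathcal A=\{(x_1,x_2)\in(C\cup D\cup G(D))^2: x_1=x_2,\ \text{or } (x_2\in D \text{ and } x_1\in G(x_2)),\ \text{or } (x_1\in D\text{ and } x_2\in G(x_1))\}$ and $\rho_{\mathcal A}(x,y)=\inf_{(u,v)\in\mathcal A}\|(x-u,y-v)\|$, where $(a,b)$ denotes the stacked vector. *)

(* Defs.v *)
From HB Require Import structures.
From mathcomp Require Import all_boot all_order all_algebra.
From mathcomp Require Import all_classical all_reals all_analysis.
Set Implicit Arguments. Unset Strict Implicit. Unset Printing Implicit Defensive.
Import Order.TTheory GRing.Theory Num.Theory.
Import numFieldNormedType.Exports.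
Local Open Scope classical_set_scope.
Local Open Scope ring_scope.

Section HybridDefs.
Variable R : realType.
Variable n : nat.
Notation vec := 'rV[R]_n.

Definition enorm (x : vec) : R := Num.sqrt (\sum_(i < n) (x ord0 i) ^+ 2).

Definition ball_e (s : R) : set vec := [set x | enorm x <= s].

Definition set_bounded (S : set vec) : Prop :=
  exists r : R, 0 < r /\ forall x, S x -> enorm x <= r.

Definition dom_sv (F : vec -> set vec) : set vec := [set x | F x !=set0].

Definition sv_image (G : vec -> set vec) (D : set vec) : set vec :=
  [set y | exists2 x, D x & G x y].

Definition sv_preimage (G : vec -> set vec) (K : set vec) : set vec :=
  [set x | exists2 y, K y & G x y].

Definition sv_opp (F : vec -> set vec) (x : vec) : set vec := [set - y | y in F x].

Definition osc_rel (F : vec -> set vec) (S : set vec) : Prop :=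
  forall (x y : vec) (xs ys : nat -> vec),
    S x -> (forall i, S (xs i)) -> xs @ \oo --> x ->
    (forall i, F (xs i) (ys i)) -> ys @ \oo --> y -> F x y.

Definition locbdd_rel (F : vec -> set vec) (S : set vec) : Prop :=
  forall x, S x -> exists delta : R, 0 < delta /\ exists m : R,
    forall y z, S y -> enorm (y - x) < delta -> F y z -> enorm z <= m.

Definition convex_set (K : set vec) : Prop :=
  forall a b (l : R), K a -> K b -> 0 <= l <= 1 -> K (l *: a + (1 - l) *: b).

Definition hybrid_basic_conditions (C : set vec) (F : vec -> set vec)
  (D : set vec) (G : vec -> set vec) : Prop :=
  [/\ closed C /\ closed D,
      [/\ osc_rel F C, locbdd_rel F C, C `<=` dom_sv F & forall x, C x -> convex_set (F x)]
    & [/\ osc_rel G D, locbdd_rel G D & D `<=` dom_sv G]].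

Definition hybrid_time_domain (E : set (R * nat)) : Prop :=
  (forall t j, E (t, j) -> 0 <= t) /\
  forall T J, E (T, J) -> exists tt : nat -> R,
    tt 0%N = 0 /\ (forall j, (j <= J)%N -> tt j <= tt j.+1) /\
    forall t j, (E (t, j) /\ 0 <= t <= T /\ (j <= J)%N) <->
                ((j <= J)%N /\ tt j <= t <= tt j.+1).

Definition Ij (E : set (R * nat)) (j : nat) : set R := [set t | E (t, j)].

Definition abs_cont_on (a b : R) (f : R -> vec) : Prop :=
  forall eps : R, 0 < eps -> exists delta : R, 0 < delta /\
    forall (m : nat) (u v : nat -> R),
      (forall k, (k < m)%N -> a <= u k /\ u k <= v k /\ v k <= b) ->
      (forall k l, (k < m)%N -> (l < m)%N -> k <> l -> v k <= u l \/ v l <= u k) ->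
      \sum_(k < m) (v k - u k) < delta ->
      \sum_(k < m) enorm (f (v k) - f (u k)) < eps.

Definition loc_abs_cont_on (I : set R) (f : R -> vec) : Prop :=
  forall a b, a <= b -> [set t | a <= t <= b] `<=` I -> abs_cont_on a b f.

(* phi : R -> nat -> vec together with its hybrid time domain E *)
Definition is_solution (C : set vec) (F : vec -> set vec) (D : set vec)
  (G : vec -> set vec) (E : set (R * nat)) (phi : R -> nat -> vec) : Prop :=
  [/\ hybrid_time_domain E /\ E (0, 0%N),
      (forall j, loc_abs_cont_on (Ij E j) (fun t => phi t j)),
      (C `|` D) (phi 0 0%N),
      (forall j, interior (Ij E j) !=set0 ->
         (forall t, interior (Ij E j) t -> C (phi t j)) /\
         {ae @lebesgue_measure R, forall t, Ij E j t ->
            derivable (fun s => phi s j) t 1 /\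
            F (phi t j) ('D_1 (fun s => phi s j) t)})
    & (forall t j, E (t, j) -> E (t, j.+1) ->
         D (phi t j) /\ G (phi t j) (phi t j.+1))].

Definition t_complete (E : set (R * nat)) : Prop :=
  forall M : R, exists t j, E (t, j) /\ M <= t.

Definition sol_bounded (E : set (R * nat)) (phi : R -> nat -> vec) : Prop :=
  exists r : R, 0 < r /\ forall t j, E (t, j) -> enorm (phi t j) <= r.

Definition tangent_cone (C : set vec) (x : vec) : set vec :=
  [set w | exists (tau : nat -> R) (ws : nat -> vec),
     (forall i, 0 < tau i) /\ tau @ \oo --> (0 : R) /\ ws @ \oo --> w /\
     forall i, C (x + tau i *: ws i)].

Definition single_valued (G : vec -> set vec) : Prop :=
  forall x y1 y2, G x y1 -> G x y2 -> y1 = y2.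

Definition proper_sv (G : vec -> set vec) : Prop :=
  forall K : set vec, compact K -> compact (sv_preimage G K).

Definition setA (C D : set vec) (G : vec -> set vec) : set (vec * vec) :=
  [set p | let U := C `|` D `|` sv_image G D in
     [/\ U p.1, U p.2 &
        p.1 = p.2 \/ (D p.2 /\ G p.2 p.1) \/ (D p.1 /\ G p.1 p.2)]].

Definition stack_norm (a b : vec) : R := Num.sqrt (enorm a ^+ 2 + enorm b ^+ 2).

Definition rhoA (C D : set vec) (G : vec -> set vec) (x y : vec) : \bar R :=
  ereal_inf [set (stack_norm (x - p.1) (y - p.2))%:E | p in setA C D G].

End HybridDefs.

(* Main.v *)
(** Near D a solution cannot flow for long by (ii), and symmetrically a solution
    near G(D) cannot have flowed for long by (iii): otherwise difference quotients
    of short pieces of arc, which lie in C and whose velocities average to almost a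
    point of the convex set F(x), would produce a common element of F(x), resp.
    -F(x), and T_C(x).  By (iv) and properness these statements are only needed,
    hence uniform, on a compact set of jump points.

    Let (u, v) in A be close to (phistar(t,j), phi(t,jt)).  If u = v there is nothing
    to do.  If u = G(v), then phi must jump shortly after t, and by continuity of G
    it lands near u.  If v = G(u), then phistar, being near D, has been flowing for a
    short time eta (D and G(D) are separated), so it suffices to match the time
    t - eta.  There u' = G(v') is excluded since phistar is still near D, and
    v' = G(u') is excluded since phi would be near G(D) at both ends of
    [t - eta, t]: it can neither flow during the whole interval nor reach D within
    it.  If t < eta, the initial condition (v) is used instead.  As G need not be
    injective, looking at phi just before its last jump would not suffice. *)
Require Import Defs.
From HB Require Import structures.
From mathcomp Require Import all_boot all_order all_algebra.
From mathcomp Require Import all_classical all_reals all_analysis.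
From mathcomp Require Import measurable_realfun ring lra.
Set Implicit Arguments.
Unset Strict Implicit.
Unset Printing Implicit Defensive.
Import Order.TTheory GRing.Theory Num.Theory.
Import numFieldNormedType.Exports.
Local Open Scope classical_set_scope.
Local Open Scope ring_scope.

(** * Comparison of the maximum norm with the Euclidean norm *)

Section Norms.
Context {R : realType} {n : nat}.
Implicit Type x : 'rV[R]_n.

Lemma coord_le_norm x i : `|x ord0 i| <= `|x|.
Proof.
rewrite [leRHS]mx_normrE.
exact: (le_bigmax _ (fun ij : 'I_1 * 'I_n => `|x ij.1 ij.2|) (ord0, i)).
Qed.

Lemma norm_le_enorm x : `|x| <= enorm x.
Proof.
rewrite [leLHS]mx_normrE; apply/bigmax_leP; split=> [|[i j] _ /=].
  exact: sqrtr_ge0.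
rewrite (ord1 i) -sqrtr_sqr ler_sqrt ?sumr_ge0// => [|k _]; last exact: sqr_ge0.
rewrite (bigD1 j)//= lerDl; apply: sumr_ge0 => k _; exact: sqr_ge0.
Qed.

(** A crude constant in place of the square root of [n]; [n.+1] is positive even for [n = 0], so
    division by it is always allowed. *)
Lemma enorm_le_norm x : enorm x <= n.+1%:R * `|x|.
Proof.
rewrite -[leRHS]ger0_norm ?mulr_ge0// -sqrtr_sqr ler_sqrt ?sqr_ge0//.
apply: (@le_trans _ _ (\sum_(i < n) `|x| ^+ 2)).
  apply: ler_sum => i _; rewrite -real_normK ?num_real//.
  by rewrite lerXn2r ?nnegrE// coord_le_norm.
rewrite sumr_const card_ord exprMn -[leLHS]mulr_natl.
apply: ler_wpM2r; first exact: sqr_ge0.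
rewrite -natrX ler_nat.
by rewrite (leq_trans (leqnSn n))// expnS expn1 leq_pmulr.
Qed.

End Norms.

(** * Sequences and compactness in finite dimension *)

Section Sequences.
Context {R : realType} {n : nat}.
Local Notation vec := 'rV[R]_n.

Lemma cvg_vecP (u : nat -> vec) (l : vec) :
  u @ \oo --> l <->
  forall e : R, 0 < e -> exists N, forall i, (N <= i)%N -> `|u i - l| < e.
Proof.
rewrite (cvgrPdist_lt _ l); split=> H e e0.
  have [N _ HN] := H e e0; exists N => i Ni; rewrite distrC; exact: HN.
by have [N HN] := H e e0; exists N => // i Ni; rewrite distrC; exact: HN.
Qed.

Lemma cvg_harmonic_bound (u : nat -> vec) (l : vec) :
  (forall k, `|u k - l| <= k.+1%:R^-1) -> u @ \oo --> l.
Proof.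
move=> ul; apply/cvg_vecP => e e0.
have [N _ HN] := near_infty_natSinv_lt (PosNum e0).
by exists N => i Ni; apply: (le_lt_trans (ul i)); exact: HN.
Qed.

Lemma closed_norm_le (r : R) : closed [set x : vec | `|x| <= r].
Proof.
apply: (@closed_comp _ _ _ [set y : R | y <= r]); last exact: closed_le.
by move=> x _; exact: norm_continuous.
Qed.

Lemma compact_vec (A : set vec) (r : R) :
  closed A -> (forall x, A x -> `|x| <= r) -> compact A.
Proof.
move=> clA bA; apply: bounded_closed_compact => //.
exists r; split; first exact: num_real.
by move=> M rM x Ax; exact: le_trans (bA _ Ax) (ltW rM).
Qed.

Lemma compact_vec_bounded (A : set vec) :
  compact A -> exists2 r : R, 0 < r & forall x, A x -> `|x| <= r.
Proof.
move=> /compact_bounded[M [_ HM]].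
exists (`|M| + 1); first by rewrite ltr_wpDl.
by move=> x Ax; apply: HM => //; rewrite (le_lt_trans (ler_norm M))// ltrDl.
Qed.

Lemma closed_avoid_ball (A : set vec) (x : vec) : closed A -> ~ A x ->
  exists2 d : R, 0 < d & forall y, `|y - x| < d -> ~ A y.
Proof.
move=> clA nAx.
have : nbhs x (~` A) by apply: open_nbhs_nbhs; split => //; exact: closed_openC.
move=> /nbhs_ballP[d d0 H]; exists d => // y yx; apply: H.
by rewrite -ball_normE /ball_ /= distrC.
Qed.

Lemma closed_adherent (A : set vec) (x : vec) : closed A ->
  (forall e : R, 0 < e -> exists2 y, A y & `|y - x| < e) -> A x.
Proof.
move=> clA H; apply: contrapT => /(closed_avoid_ball clA)[d d0 Hd].
by have [y Ay yx] := H _ d0; exact: (Hd y yx Ay).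
Qed.

(** The selection [s] need not be increasing: [k <= s k] already lets every bound that decreases in
    the index pass to the selected terms. *)
Lemma bounded_seq_cluster (u : nat -> vec) (r : R) :
  (forall i, `|u i| <= r) ->
  exists (s : nat -> nat) (l : vec),
    (forall k, (k <= s k)%N) /\ forall k, `|u (s k) - l| <= k.+1%:R^-1.
Proof.
move=> ur.
have cB : compact [set x : vec | `|x| <= r].
  by apply: (@compact_vec _ r) => //; exact: closed_norm_le.
have [|l [_ cl]] := cB (u @ \oo) _.
  by exists 0%N => // i _; exact: ur.
suff /choice[s Hs] : forall k, exists m, (k <= m)%N /\ `|u m - l| <= k.+1%:R^-1.
  by exists s, l; split=> k; have [] := Hs k.
move=> k.
have k0 : (0 : R) < k.+1%:R^-1 by rewrite invr_gt0.
have [] := cl [set x | exists2 m, (k <= m)%N & u m = x] (ball l k.+1%:R^-1).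
- by exists k => // m km; exists m.
- exact: nbhsx_ballx.
- move=> _ [[m km <-]]; rewrite -ball_normE /ball_ /= distrC => um.
  by exists m; split=> //; exact: ltW.
Qed.

(** Near-covering compactness: the point and the scale [e] vary jointly, so one scale serves all of
    [K]. Local estimates become uniform through it. *)
Lemma compact_uniform (K : set vec) (P : R -> vec -> Prop) :
  compact K ->
  (forall x, K x -> exists2 d : R, 0 < d &
     forall y e, `|y - x| < d -> 0 < e -> e < d -> P e y) ->
  exists2 d : R, 0 < d & forall x, K x -> P d x.
Proof.
move=> /compact_near_coveringP cK HP.
have /filter_ex : \forall e \near (0 : R)^'+, 0 < e /\ K `<=` P e.
  near=> e; split; first by near: e; exact: nbhs_right_gt.
  near: e; apply: cK => x Kx.
  have [d d0 Hd] := HP x Kx.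
  exists (ball x d, [set e : R | 0 < e < d]) => /=.
    split; first exact: nbhsx_ballx.
    by apply: filterS (filterI (nbhs_right_gt 0) (nbhs_right_lt d0)) => e [/= -> ->].
  move=> [y e] /= [].
  by rewrite -ball_normE /ball_ /= distrC => yx /andP[e0 ed]; exact: Hd.
by move=> [e [e0 He]]; exists e.
Unshelve. all: by end_near.
Qed.

End Sequences.

(** * Outer semicontinuous, locally bounded set-valued maps *)

Section SetValued.
Context {R : realType} {n : nat}.
Local Notation vec := 'rV[R]_n.
Variables (S : set vec) (F : vec -> set vec).
Hypotheses (oscF : osc_rel F S) (lbF : locbdd_rel F S).

Lemma locbdd_norm (x : vec) : S x -> exists2 d : R, 0 < d & exists2 m : R, 0 < m &
  forall y z, S y -> `|y - x| < d -> F y z -> `|z| <= m.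
Proof.
move=> Sx; have [d [d0 [m Hm]]] := lbF Sx.
exists (d / n.+1%:R); first by rewrite divr_gt0.
exists (`|m| + 1); first by rewrite ltr_wpDl.
move=> y z Sy yx Fz; apply: (le_trans (norm_le_enorm _)).
apply: (@le_trans _ _ m); last by rewrite (le_trans (ler_norm m))// lerDl.
apply: (Hm y) => //; apply: (le_lt_trans (enorm_le_norm _)).
by rewrite mulrC -ltr_pdivlMr.
Qed.

(** Otherwise bad values at points tending to [x] would be bounded, hence cluster; outer
    semicontinuity puts the cluster point in [F x], closer than [e] to some bad value. *)
Lemma osc_locbdd_usc (x : vec) (e : R) : S x -> 0 < e ->
  exists2 d : R, 0 < d & forall y z, S y -> `|y - x| < d -> F y z ->
    exists2 w, F x w & `|z - w| < e.
Proof.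
move=> Sx e0; apply: contrapT => H.
have [d d0 [m m0 Hm]] := locbdd_norm Sx.
have {H} /choice[p Hp] : forall k, exists p : vec * vec,
    [/\ S p.1, `|p.1 - x| < Num.min d k.+1%:R^-1, F p.1 p.2 &
        forall w, F x w -> e <= `|p.2 - w|].
  move=> k; apply: contrapT => H1; apply: H.
  exists (Num.min d k.+1%:R^-1); first by rewrite lt_min d0/= invr_gt0.
  move=> y z Sy yx Fz; apply: contrapT => H2; apply: H1.
  exists (y, z); split => // w Fw; rewrite leNgt; apply/negP => zw; apply: H2.
  by exists w.
have [|s [l [ks sl]]] := @bounded_seq_cluster R n (fun k => (p k).2) m.
  move=> k; have [S1 x1 F1 _] := Hp k; apply: (Hm _ _ S1 _ F1).
  by move: x1; rewrite lt_min => /andP[].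
have Fl : F x l.
  apply: (oscF (xs := fun k => (p (s k)).1) (ys := fun k => (p (s k)).2)) => //.
  - by move=> i; have [] := Hp (s i).
  - apply: cvg_harmonic_bound => k.
    have [_ + _ _] := Hp (s k); rewrite lt_min => /andP[_ /ltW/le_trans]; apply.
    by rewrite lef_pV2 ?posrE// ler_nat ltnS.
  - by move=> i; have [] := Hp (s i).
  - exact: cvg_harmonic_bound.
have [N _ HN] := near_infty_natSinv_lt (PosNum e0).
have [_ _ _ /(_ l Fl)] := Hp (s N).
by rewrite leNgt (le_lt_trans (sl N))//; apply: HN => /=.
Qed.

Lemma compact_image_bounded (K : set vec) : compact K -> K `<=` S ->
  exists2 m : R, 0 < m & forall y z, K y -> F y z -> `|z| <= m.
Proof.
move=> cK KS.
(* [compact_uniform] yields a small parameter, so the bound is sought in the form [d^-1]. *)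
pose P (d : R) y := S y -> forall z, F y z -> `|z| <= d^-1.
have [|d d0 Hd] := @compact_uniform _ _ K P cK.
  move=> x /KS Sx; have [d d0 [m m0 Hm]] := locbdd_norm Sx.
  exists (Num.min d m^-1); first by rewrite lt_min d0/= invr_gt0.
  move=> y e; rewrite !lt_min => /andP[yx _] e0 /andP[_ em] Sy z Fz.
  apply: (le_trans (Hm y z Sy yx Fz)).
  by rewrite -[leLHS]invrK lef_pV2 ?posrE ?invr_gt0// ltW.
exists d^-1; first by rewrite invr_gt0.
by move=> y z Ky; apply: Hd => //; exact: KS.
Qed.

End SetValued.

(** * A mean value inclusion for absolutely continuous curves *)

Section MeanValue.
Context {R : realType}.

(** Cousin's lemma on tagged partitions as an induction: [c] is the tag of the step from [u] to [v].
    With the supremum of the good points as tag, one step reaches it and another passes beyond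
    it. *)
Lemma gauge_induction (a b : R) (Q : R -> Prop) : a <= b -> Q a ->
  (forall c, a <= c -> c <= b -> exists2 g : R, 0 < g &
     forall u v, a <= u -> u <= c -> c <= v -> v <= b -> u < v ->
       c - g < u -> v < c + g -> Q u -> Q v) ->
  Q b.
Proof.
move=> ab Qa Hg.
pose S := [set c | [/\ a <= c, c <= b & Q c]].
have Sa : S a by split.
have supS : has_sup S by split; [exists a | exists b => x []].
have aS : a <= sup S by apply: ub_le_sup => //; case: supS.
have Sb : sup S <= b by apply: ge_sup => //; [exists a | move=> x []].
have [g g0 Hg1] := Hg _ aS Sb.
have QS : Q (sup S).
  have [c [ac cb Qc] Sc] := sup_adherent g0 supS.
  have cS : c <= sup S by apply: ub_le_sup; [case: supS | split].
  have [<-//|cS'] := eqVneq c (sup S).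
  by apply: (Hg1 c) => //; rewrite ?lt_neqAle ?cS'// -?lt_neqAle ltrDl.
have [<-//|Sb'] := eqVneq (sup S) b.
have {Sb'}Sb' : sup S < b by rewrite lt_neqAle Sb'.
pose v := Num.min b (sup S + g / 2).
have Sv : sup S < v by rewrite lt_min Sb'/= ltrDl divr_gt0.
have vb : v <= b by rewrite ge_min lexx.
have Qv : Q v.
  apply: (Hg1 (sup S)) => //; [exact: ltW| by rewrite ltrBlDr ltrDl|].
  by rewrite gt_min; apply/orP; right; rewrite ltrD2l ltr_pdivrMr// mulr_natr mulr2n ltrDl.
have : S v by split => //; exact: le_trans aS (ltW Sv).
by move/(ub_le_sup (proj2 supS)); rewrite leNgt Sv.
Qed.

Context {n : nat}.
Local Notation vec := 'rV[R]_n.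

(** The straddle lemma: the errors on the two sides of [c] add up because
    [(v - c) + (c - u) = v - u]. *)
Lemma derivable_straddle (f : R -> vec) (c e : R) : derivable f c 1 -> 0 < e ->
  exists2 g : R, 0 < g & forall u v, u <= c -> c <= v -> c - g < u -> v < c + g ->
    `|f v - f u - (v - u) *: 'D_1 f c| <= e * (v - u).
Proof.
move=> df e0.
have /cvgrPdist_lt/(_ e e0) := df.
move=> /nbhs_ballP[g /= g0 Hg].
exists g => //.
have H h : `|h| < g -> `|f (c + h) - f c - h *: 'D_1 f c| <= e * `|h|.
  move=> hg; have [->|h0] := eqVneq h 0.
    by rewrite addr0 subrr scale0r subrr !normr0 mulr0.
  have := Hg h; rewrite -ball_normE /ball_ /= sub0r normrN => /(_ hg h0) /ltW H.
  rewrite -(@ler_pM2l _ `|h|) ?normr_gt0// in H.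
  rewrite [e * _]mulrC; apply: le_trans H; rewrite -normrZ scalerBr scalerA divff//.
  rewrite scale1r distrC (_ : h *: 1 + c = c + h)//.
  by rewrite addrC [h *: _]mulr1.
move=> u v uc cv gu vg.
have -> : f v - f u - (v - u) *: 'D_1 f c =
  (f (c + (v - c)) - f c - (v - c) *: 'D_1 f c) -
  (f (c + (u - c)) - f c - (u - c) *: 'D_1 f c).
  have -> : c + (v - c) = v by lra.
  have -> : c + (u - c) = u by lra.
  by move: ('D_1 f c) => D; apply/rowP => i; rewrite !mxE; ring.
apply: (le_trans (ler_normB _ _)).
have hv : `|v - c| = v - c by rewrite ger0_norm// subr_ge0.
have hu : `|u - c| = c - u by rewrite ler0_norm ?opprB// subr_le0.
have -> : e * (v - u) = e * (v - c) + e * (c - u) by rewrite -mulrDr; congr (_ * _); lra.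
apply: lerD; [rewrite -[leRHS](congr1 _ hv) | rewrite -[leRHS](congr1 _ hu)];
  apply: H; rewrite ?hv ?hu; lra.
Qed.


Lemma le_lebesgue_measure (A B : set R) : measurable A -> measurable B ->
  A `<=` B -> (lebesgue_measure A <= lebesgue_measure B)%E.
Proof. by move=> mA mB AB; apply: le_measure => //; rewrite inE. Qed.

Lemma negligible_open_cover (N : set R) (d : R) : lebesgue_measure.-negligible N ->
  0 < d -> exists U : set R,
    [/\ open U, N `<=` U & (lebesgue_measure U < d%:E)%E].
Proof.
move=> [A [mA A0 NA]] d0.
have [|U [oU AU Ud]] := lebesgue_regularity_outer mA _ d0.
  by rewrite [ltLHS]A0 ltry.
exists U; split => //; first exact: subset_trans AU.
apply: le_lt_trans Ud.
have mU : measurable U := open_measurable oU.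
rewrite (measureDI lebesgue_measure mU mA) -[leRHS]adde0 leeD2l// -A0.
by apply: le_lebesgue_measure => //; exact: measurableI.
Qed.

(** Keeps the total length of the exceptional intervals below the measure of the part of [U] already
    crossed, when []c, d]] is appended. *)
Lemma measure_setI_itv_step (U : set R) (a c d x : R) : measurable U ->
  a <= c -> c <= d -> `]c, d] `<=` U ->
  (x%:E <= lebesgue_measure (U `&` `]a, c]))%E ->
  ((x + (d - c))%:E <= lebesgue_measure (U `&` `]a, d]))%E.
Proof.
move=> mU ac cd cdU xa.
have mI (p q : R) : measurable (U `&` `]p, q]) by exact: measurableI.
apply: (@le_trans _ _ (lebesgue_measure (U `&` `]a, c]) + lebesgue_measure `]c, d]))%E.
  rewrite EFinD leeD// lebesgue_measure_itv /= lte_fin.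
  by case: ltP => dc; rewrite -?EFinB lee_fin; lra.
rewrite -(measureU lebesgue_measure (mI a c) (measurable_itv _)); last first.
  rewrite -subset0 => y [[_ /=]]; rewrite !in_itv /= => /andP[_ yc] /andP[cy _].
  by move: (lt_le_trans cy yc); rewrite ltxx.
apply: le_lebesgue_measure => //; first by apply: measurableU => //; exact: mI.
move=> y [[Uy]|cy]; rewrite /= !in_itv /=.
  by move=> /andP[ay yc]; split=> //; rewrite ay (le_trans yc).
split; first exact: cdU.
by move: cy; rewrite /= !in_itv /= => /andP[cy ->]; rewrite (le_lt_trans ac).
Qed.

(** Weights proportional to lengths: mean velocities over adjacent intervals combine into a mean
    velocity in [K]. *)
Lemma convex_set_add (K : set vec) (a u v : R) (x y : vec) : Defs.convex_set K ->
  K x -> K y -> a <= u -> u < v ->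
  exists2 z, K z & (v - a) *: z = (u - a) *: x + (v - u) *: y.
Proof.
move=> cvK Kx Ky au uv; have va0 : 0 < v - a by lra.
exists (((u - a) / (v - a)) *: x + (1 - (u - a) / (v - a)) *: y).
  apply: cvK => //; rewrite divr_ge0 ?subr_ge0 ?(le_trans au) ?(ltW uv)//=.
  by rewrite ler_pdivrMr// mul1r; lra.
by apply/rowP => i; rewrite !mxE; field; rewrite gt_eqF.
Qed.

(* A gauge argument in place of the fundamental theorem of calculus: intervals
   tagged outside the exceptional null set are controlled by differentiability,
   the others lie in an open set of small measure, where absolute continuity
   applies. *)
Lemma abs_cont_mean_value (a b : R) (f : R -> vec) (K : set vec) (k0 : vec) :
  a < b -> abs_cont_on a b f -> Defs.convex_set K -> K k0 ->
  {ae @lebesgue_measure R, forall t, a <= t <= b ->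
     derivable f t 1 /\ K ('D_1 f t)} ->
  forall e : R, 0 < e ->
  exists2 k, K k & `|f b - f a - (b - a) *: k| <= e.
Proof.
move=> ab acf cvK Kk0 aeK e e0.
(* The error [e] is split in three: differentiability ([e1]), variation of [f] on the exceptional
   intervals ([d1]), and the displacement by [k0] assigned to them ([d2]). *)
have [d1 [d10 Hd1]] := acf (e / 3) ltac:(lra).
have k01 : 0 < `|k0| + 1 by rewrite ltr_wpDl.
pose d2 := e / 3 / (`|k0| + 1).
have d20 : 0 < d2 by rewrite divr_gt0//; lra.
have d0 : 0 < Num.min d1 d2 by rewrite lt_min d10.
have [U [oU NU Ud]] := negligible_open_cover aeK d0.
have mU : measurable U := open_measurable oU.
pose e1 := e / 3 / (b - a).
have e10 : 0 < e1 by rewrite divr_gt0//; lra.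
(* [Q c] records the exceptional intervals met up to [c] and a mean velocity [k] in which each of
   them counts with the arbitrary element [k0] of [K]. *)
pose Q c := exists (m : nat) (u v : nat -> R) (k : vec),
  [/\ (forall i, (i < m)%N -> [/\ a <= u i, u i <= v i & v i <= c]),
      (forall i j, (i < m)%N -> (j < m)%N -> i <> j -> v i <= u j \/ v j <= u i),
      ((\sum_(i < m) (v i - u i))%:E <= lebesgue_measure (U `&` `]a, c]))%E,
      K k &
      `|f c - f a - (c - a) *: k| <= e1 * (c - a) +
         \sum_(i < m) (`|f (v i) - f (u i)| + `|k0| * (v i - u i))].
have : Q b.
  apply: (@gauge_induction a b Q (ltW ab)).
    exists 0%N, (fun=> 0), (fun=> 0), k0; split => //.
      by rewrite big_ord0.
    by rewrite !subrr scale0r !subrr normr0 mulr0 big_ord0 addr0.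
  move=> c ac cb; have [Uc|nUc] := pselect (U c).
    have /nbhs_ballP[g /= g0 Hg] : nbhs c U by exact: open_nbhs_nbhs.
    exists g => // u v au uc cv vb uv gu vg [m [us [vs [k [Hm dis meas Kk Hk]]]]].
    have [z Kz Ez] := convex_set_add cvK Kk Kk0 au uv.
    exists m.+1, (fun i => if (i < m)%N then us i else u),
      (fun i => if (i < m)%N then vs i else v), z; split => //.
    - move=> i _; case: ifP => [im|_].
        by have [-> -> vu] := Hm i im; split=> //; exact: le_trans vu (ltW uv).
      by split=> //; exact: ltW.
    - move=> i j; rewrite !ltnS => im jm ij.
      case: (ltnP i m) => [im'|mi]; case: (ltnP j m) => [jm'|mj].
      + exact: dis.
      + by left; have [] := Hm i im'.
      + by right; have [] := Hm j jm'.
      + by exfalso; apply: ij; apply/eqP; rewrite eqn_leq (leq_trans im mj) (leq_trans jm mi).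
    - rewrite big_ord_recr /= ltnn.
      under eq_bigr do rewrite ltn_ord.
      apply: measure_setI_itv_step => //; first exact: ltW.
      move=> y; rewrite /= in_itv /= => /andP[uy yv]; apply: Hg.
      by rewrite -ball_normE /ball_ /= ltr_norml; lra.
    - rewrite big_ord_recr /= ltnn.
      under eq_bigr do rewrite ltn_ord.
      have -> : f v - f a - (v - a) *: z =
        (f u - f a - (u - a) *: k) + ((f v - f u) - (v - u) *: k0).
        by rewrite Ez; apply/rowP => i; rewrite !mxE; ring.
      apply: (le_trans (ler_normD _ _)).
      have := ler_normB (f v - f u) ((v - u) *: k0).
      rewrite normrZ (ger0_norm (x := v - u)) ?subr_ge0 ?(ltW uv)// => H.
      set s := \sum_(i < m) _ in Hk *.
      have : e1 * (v - a) = e1 * (u - a) + e1 * (v - u) by ring.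
      have : 0 < e1 * (v - u) by rewrite mulr_gt0// subr_gt0.
      move: Hk H; rewrite [(v - u) * _]mulrC; lra.
  have [dfc Kc] : derivable f c 1 /\ K ('D_1 f c).
    apply: contrapT => H; apply: nUc; apply: NU => /= H1; apply: H; apply: H1.
    by rewrite ac cb.
  have [g g0 Hg] := derivable_straddle dfc e10.
  exists g => // u v au uc cv vb uv gu vg [m [us [vs [k [Hm dis meas Kk Hk]]]]].
  have [z Kz Ez] := convex_set_add cvK Kk Kc au uv.
  exists m, us, vs, z; split => //.
  - by move=> i im; have [-> -> vu] := Hm i im; split=> //; exact: le_trans vu (ltW uv).
  - apply: (le_trans meas); apply: le_lebesgue_measure; [exact: measurableI|exact: measurableI|].
    move=> y [Uy]; rewrite /= !in_itv /= => /andP[ay yu]; split=> //.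
    by rewrite ay (le_trans yu)// ltW.
  - have {}Hg := Hg u v uc cv gu vg.
    have -> : f v - f a - (v - a) *: z =
        (f u - f a - (u - a) *: k) + ((f v - f u) - (v - u) *: 'D_1 f c).
      by rewrite Ez; move: ('D_1 f c) => D; apply/rowP => i; rewrite !mxE; ring.
    apply: (le_trans (ler_normD _ _)).
    set s := \sum_(i < m) _ in Hk *.
    have : e1 * (v - a) = e1 * (u - a) + e1 * (v - u) by ring.
    move: Hk Hg; lra.
move=> [m [u [v [k [Hm dis meas Kk Hk]]]]]; exists k => //.
have sd : \sum_(i < m) (v i - u i) < Num.min d1 d2.
  rewrite -lte_fin; apply: le_lt_trans Ud; apply: (le_trans meas).
  by apply: le_lebesgue_measure => //; exact: measurableI.
move: sd; rewrite lt_min => /andP[sd1 sd2].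
have H1 : \sum_(i < m) `|f (v i) - f (u i)| < e / 3.
  apply: le_lt_trans (Hd1 m u v _ dis sd1); first by apply: ler_sum => i _; exact: norm_le_enorm.
  by move=> i im; have [] := Hm i im.
have H2 : `|k0| * \sum_(i < m) (v i - u i) <= e / 3.
  apply: (@le_trans _ _ ((`|k0| + 1) * d2)).
    apply: ler_pM => //; [|by rewrite lerDl|exact: ltW].
    by apply: sumr_ge0 => i _; rewrite subr_ge0; have [] := Hm i (ltn_ord i).
  by rewrite mulrC divfK// gt_eqF.
have H3 : e1 * (b - a) = e / 3 by rewrite divfK// gt_eqF// subr_gt0.
apply: (le_trans Hk); rewrite big_split /= -mulr_sumr H3; lra.
Qed.

End MeanValue.

(** * Flow arcs: short travel and tangent directions *)

Section Arcs.
Context {R : realType} {n : nat}.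
Local Notation vec := 'rV[R]_n.

(* Flow arcs, through the only consequence of [f' \in F f] that is used; unlike
   the differential inclusion, it is visibly stable under time reversal. *)
Definition flow_arc (C : set vec) (F : vec -> set vec) (a b : R) (f : R -> vec) :=
  [/\ forall t, a <= t <= b -> forall e : R, 0 < e -> exists2 d : R, 0 < d &
        forall s, a <= s <= b -> `|s - t| < d -> `|f s - f t| < e,
      a < b -> forall t, a <= t <= b -> C (f t) &
      forall c d (K : set vec), a <= c -> c < d -> d <= b -> Defs.convex_set K ->
        (forall t, c <= t <= d -> F (f t) `<=` K) -> forall e : R, 0 < e ->
        exists2 k, K k & `|f d - f c - (d - c) *: k| <= e].

Lemma flow_arc_sub C F a b f a' b' : flow_arc C F a b f ->
  a <= a' -> b' <= b -> flow_arc C F a' b' f.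
Proof.
move=> [cf Cf mf] aa bb.
have sub t : a' <= t <= b' -> a <= t <= b.
  by move=> /andP[at' tb]; rewrite (le_trans aa)// (le_trans tb).
split=> [t /sub tab e e0|ab t tab|c d K ac cd db].
- by have [d d0 Hd] := cf t tab e e0; exists d => // s /sub; exact: Hd.
- by apply: Cf; [exact: le_lt_trans aa (lt_le_trans ab bb) | exact: sub].
- by apply: mf => //; [exact: le_trans ac | exact: le_trans bb].
Qed.

Lemma convex_set_opp (K : set vec) :
  Defs.convex_set K -> Defs.convex_set [set - y | y in K].
Proof.
move=> cvK _ _ l [x Kx <-] [y Ky <-] l01.
exists (l *: x + (1 - l) *: y); first exact: cvK.
by rewrite opprD !scalerN.
Qed.

(** Reversal turns assumption (iii), about the end of an arc, into the form of (ii), about its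
    start, so one study of initial points serves both. *)
Lemma flow_arc_rev C F a b f : flow_arc C F a b f ->
  flow_arc C (sv_opp F) (- b) (- a) (fun t => f (- t)).
Proof.
move=> [cf Cf mf].
have sub t : - b <= t <= - a -> a <= - t <= b by lra.
split=> [t /sub tab e e0|ab t tab|c d K ac cd db cvK FK e e0].
- have [d d0 Hd] := cf _ tab e e0; exists d => // s /sub sab st.
  by apply: Hd => //; rewrite -opprD normrN.
- by apply: Cf; [lra | exact: sub].
- have a1 : a <= - d by lra.
  have a2 : - d < - c by lra.
  have a3 : - c <= b by lra.
  have [|k [k' Kk' <-] Hk] := mf _ _ _ a1 a2 a3 (convex_set_opp cvK) _ e e0.
    move=> t tcd y Fy; exists (- y); last by rewrite opprK.
    by apply: (FK (- t)); [lra | exists y; rewrite ?opprK].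
  exists k' => //; apply: le_trans Hk; rewrite -normrN.
  rewrite le_eqVlt; apply/orP; left; apply/eqP; congr (`|_|).
  by apply/rowP => i; rewrite !mxE; ring.
Qed.

Variables (C : set vec) (F : vec -> set vec).
Hypotheses (clC : closed C) (oscF : osc_rel F C) (lbF : locbdd_rel F C).

Lemma convex_norm_le (m : R) : Defs.convex_set [set x : vec | `|x| <= m].
Proof.
move=> x y l /= xm ym /andP[l0 l1]; apply: (le_trans (ler_normD _ _)).
rewrite !normrZ !ger0_norm ?subr_ge0//.
have := ler_wpM2l l0 xm; have := @ler_wpM2l _ (1 - l) ltac:(lra) _ _ ym; lra.
Qed.

(** Bootstrap: while the arc stays in the ball of radius [r + rho] its velocities are bounded by
    [M], which keeps it well inside up to time [rho / (2 * M)]. *)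
Lemma flow_arc_short_travel (r rho : R) : 0 < rho -> exists2 eta : R, 0 < eta &
  forall a b f, flow_arc C F a b f -> a <= b -> b - a <= eta -> `|f a| <= r ->
    `|f b - f a| < rho.
Proof.
move=> rho0.
have cK : compact (C `&` [set x | `|x| <= r + rho]).
  apply: (@compact_vec _ _ _ (r + rho)); last by move=> x [].
  by apply: closedI => //; exact: closed_norm_le.
have [|M M0 HM] := compact_image_bounded lbF cK; first by move=> x [].
exists (rho / (2 * M)); first by rewrite divr_gt0// mulr_gt0.
move=> a b f [cf Cf mf]; rewrite le_eqVlt => /predU1P[->|ab] ba fr.
  by rewrite subrr normr0.
have Mv v : a <= v -> v <= b -> M * (v - a) <= rho / 2.
  move=> av vb; apply: (@le_trans _ _ (M * (rho / (2 * M)))).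
    by rewrite ler_wpM2l// ?(ltW M0)//; lra.
  by rewrite le_eqVlt; apply/orP; left; apply/eqP; field; rewrite gt_eqF.
(* The first clause makes [M] applicable; the second leaves a displacement of at most [rho / 2], so
   that continuity up to [rho / 4], used twice around the tag, restores the first. *)
pose Q v := (forall s, a <= s <= v -> `|f s - f a| <= rho) /\ `|f v - f a| <= M * (v - a).
suff [_ H] : Q b by apply: (le_lt_trans H); have := Mv b (ltW ab) (lexx b); lra.
apply: (@gauge_induction _ a b Q (ltW ab)).
  split=> [s|]; last by rewrite !subrr normr0 mulr0.
  by rewrite -eq_le => /eqP <-; rewrite subrr normr0 ltW.
move=> c ac cb.
have [||g g0 Hg] := cf c _ (rho / 4); [by rewrite ac|lra|].
exists g => // u v au uc cv vb uv gu vg [Hu1 Hu2].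
have Hv s : a <= s <= v -> `|f s - f a| <= rho.
  move=> /andP[as' sv]; have [su|us] := leP s u; first by apply: Hu1; rewrite as'.
  have H1 : `|f s - f c| < rho / 4 by apply: Hg; rewrite ?ltr_norml; lra.
  have H2 : `|f u - f c| < rho / 4 by apply: Hg; rewrite ?ltr_norml; lra.
  have := Mv u au ltac:(lra).
  have -> : f s - f a = (f s - f c) - (f u - f c) + (f u - f a).
    by apply/rowP => i; rewrite !mxE; ring.
  move: (ler_normD (f s - f c - (f u - f c)) (f u - f a)).
  move: (ler_normB (f s - f c) (f u - f c)); lra.
split=> //.
apply/ler_addgt0Pr => e e0.
have av : a < v by lra.
have [|k /= Mk Hk] := mf a v [set x | `|x| <= M] (lexx a) av vb (@convex_norm_le M) _ e e0.
  move=> t tav z Fz; apply: (HM (f t)) => //; split; first by apply: Cf => //; lra.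
  have := Hv t tav; have := ler_normD (f t - f a) (f a).
  by rewrite subrK /=; lra.
have := ler_normD (f v - f a - (v - a) *: k) ((v - a) *: k).
rewrite subrK normrZ gtr0_norm ?subr_gt0// => /le_trans; apply.
rewrite addrC lerD// mulrC ler_wpM2r// subr_ge0; exact: ltW.
Qed.

(** The velocities [w'] are bounded, so they cluster; the limit is in [F x] by outer semicontinuity
    and tangent because the [w] share it. *)
Lemma tangent_of_approx (x : vec) : C x ->
  (forall e : R, 0 < e -> exists tau w w',
    [/\ 0 < tau, tau <= e, F x w', `|w - w'| <= e & C (x + tau *: w)]) ->
  F x `&` tangent_cone C x !=set0.
Proof.
move=> Cx H.
have /choice[p Hp] : forall k, exists p : R * vec * vec,
    [/\ 0 < p.1.1, p.1.1 <= k.+1%:R^-1, F x p.2, `|p.1.2 - p.2| <= k.+1%:R^-1 &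
      C (x + p.1.1 *: p.1.2)].
  move=> k; have [|tau [w [w' [? ? ? ? ?]]]] := H k.+1%:R^-1.
    by rewrite invr_gt0.
  by exists (tau, w, w').
have [d d0 [m m0 Hm]] := locbdd_norm lbF Cx.
have [|s [l [ks sl]]] := @bounded_seq_cluster R n (fun k => (p k).2) m.
  move=> k; have [_ _ Fk _ _] := Hp k; apply: (Hm x) => //.
  by rewrite subrr normr0.
have sk k : (s k).+1%:R^-1 <= k.+1%:R^-1 :> R.
  by rewrite lef_pV2 ?posrE// ler_nat ltnS.
exists l; split.
  apply: (oscF (xs := fun=> x) (ys := fun k => (p (s k)).2)) => //.
  - exact: cvg_cst.
  - by move=> i; have [] := Hp (s i).
  - exact: cvg_harmonic_bound.
exists (fun k => (p (s k)).1.1), (fun k => (p (s k)).1.2); split.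
  by move=> i; have [] := Hp (s i).
split.
  apply/cvgrPdist_lt => e e0.
  have [N _ HN] := near_infty_natSinv_lt (PosNum e0).
  exists N => // i Ni /=; have [p0 pi _ _ _] := Hp (s i).
  rewrite sub0r normrN gtr0_norm//.
  exact: le_lt_trans (le_trans pi (sk i)) (HN i Ni).
split; last by move=> i; have [] := Hp (s i).
apply/cvg_vecP => e e0.
have e20 : 0 < e / 2 by lra.
have [N _ HN] := near_infty_natSinv_lt (PosNum e20).
exists N => i Ni; have /= Hi := HN i Ni; have [_ _ _ H1 _] := Hp (s i).
have := ler_normD ((p (s i)).1.2 - (p (s i)).2) ((p (s i)).2 - l).
rewrite addrA subrK => /le_lt_trans; apply.
have /= H2 := sl i; have H3 := sk i.
have H4 : i.+1%:R^-1 < e / 2 by exact: Hi.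
rewrite [e]splitr; apply: ltrD; first exact: le_lt_trans (le_trans H1 H3) H4.
exact: le_lt_trans H2 H4.
Qed.

Hypothesis cvF : forall x, C x -> Defs.convex_set (F x).

(** Were long arcs to start arbitrarily near [x], their difference quotients over a short time [h]
    would point into [C] and almost lie in [F x]. For [x] outside [C], closedness suffices. *)
Lemma no_long_flow_arc_local (x : vec) (eta : R) : 0 < eta ->
  (C x -> F x `&` tangent_cone C x = set0) ->
  exists2 d : R, 0 < d & forall a b f, flow_arc C F a b f ->
    eta <= b - a -> ~ `|f a - x| < d.
Proof.
move=> eta0 Hx.
have [Cx|nCx] := pselect (C x); last first.
  have [d d0 Hd] := closed_avoid_ball clC nCx; exists d => // a b f [_ Cf _] ab fd.
  by apply: (Hd _ fd); apply: Cf; [lra | rewrite lexx; lra].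
apply: contrapT => H; have : F x `&` tangent_cone C x !=set0; last first.
  by rewrite Hx// => -[].
apply: tangent_of_approx => // e e0.
have e30 : 0 < e / 3 by lra.
have [r r0 Hr] := osc_locbdd_usc oscF lbF Cx e30.
have r20 : 0 < r / 2 by lra.
have [h1 h10 Hh1] := flow_arc_short_travel (`|x| + 1) r20.
pose h := Num.min eta (Num.min h1 e).
have h0 : 0 < h by rewrite !lt_min eta0 h10.
have heta : h <= eta by rewrite ge_min lexx.
have hh1 : h <= h1 by rewrite !ge_min lexx !orbT.
have he : h <= e by rewrite !ge_min lexx !orbT.
(* The initial error is divided by [h] in the quotient, where it may cost [e / 3]. *)
pose d := Num.min 1 (Num.min (r / 2) (h * (e / 3))).
have d0 : 0 < d by rewrite !lt_min ltr01 r20 mulr_gt0.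
have d1 : d <= 1 by rewrite ge_min lexx.
have dr : d <= r / 2 by rewrite !ge_min lexx !orbT.
have dh : d <= h * (e / 3) by rewrite !ge_min lexx !orbT.
have [a [b [f [arcf ab fd]]]] : exists a b f,
    [/\ flow_arc C F a b f, eta <= b - a & `|f a - x| < d].
  apply: contrapT => H1; apply: H; exists d => // a b f arcf ab fd; apply: H1.
  by exists a, b, f.
have [_ Cf mf] := arcf.
have fa1 : `|f a| <= `|x| + 1.
  have := ler_normD (f a - x) x; rewrite subrK; lra.
pose K := [set z | exists2 w, F x w & `|z - w| <= e / 3].
have cvK : Defs.convex_set K.
  move=> z1 z2 l [w1 Fw1 zw1] [w2 Fw2 zw2] l01.
  exists (l *: w1 + (1 - l) *: w2); first exact: cvF.
  rewrite (_ : _ - _ = l *: (z1 - w1) + (1 - l) *: (z2 - w2)).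
    exact: (@convex_norm_le (e / 3)).
  by apply/rowP => i; rewrite !mxE; ring.
have he30 : 0 < h * (e / 3) by rewrite mulr_gt0.
have a1 : a < a + h by lra.
have a2 : a + h <= b by lra.
have [|k [w Fw kw] Hk] := mf a (a + h) K (lexx a) a1 a2 cvK _ _ he30.
  move=> t /andP[at' th] z Fz.
  have [||w Fw zw] := Hr (f t) z _ _ Fz; last by exists w => //; exact: ltW.
    by apply: Cf; lra.
  have arct : flow_arc C F a t f by apply: flow_arc_sub arcf _ _; lra.
  have := Hh1 a t f arct at' ltac:(lra) fa1.
  have := ler_normD (f t - f a) (f a - x).
  rewrite addrA subrK; lra.
(* Based at [x] rather than at [f a], so that [x + h *: v] is the point [f (a + h)] of [C]. *)
pose v := h^-1 *: (f (a + h) - x).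
exists h, v, w; split => //; last first.
  by rewrite scalerA divff ?gt_eqF// scale1r addrC subrK; apply: Cf; lra.
have -> : v - w = h^-1 *: ((f (a + h) - f a - (a + h - a) *: k) + (f a - x)) + (k - w).
  by apply/rowP => i; rewrite !mxE; field; rewrite gt_eqF.
apply: (le_trans (ler_normD _ _)); rewrite normrZ gtr0_norm ?invr_gt0//.
have H2 : h^-1 * `|f (a + h) - f a - (a + h - a) *: k + (f a - x)| <= 2 * (e / 3).
  rewrite ler_pdivrMl//.
  move: (ler_normD (f (a + h) - f a - (a + h - a) *: k) (f a - x)); lra.
lra.
Qed.

Lemma no_long_flow_arc (K : set vec) (eta : R) : compact K -> 0 < eta ->
  (forall x, K x -> C x -> F x `&` tangent_cone C x = set0) ->
  exists2 d : R, 0 < d & forall a b f x, flow_arc C F a b f -> K x ->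
    `|f a - x| < d -> b - a < eta.
Proof.
move=> cK eta0 HK.
pose P (d : R) x := forall a b f, flow_arc C F a b f -> eta <= b - a -> ~ `|f a - x| < d.
have [|d d0 Hd] := @compact_uniform _ _ K P cK.
  move=> x Kx; have [d d0 Hd] := no_long_flow_arc_local eta0 (HK x Kx).
  exists (d / 2); first by lra.
  move=> y e yx e0 ed a b f arcf ab fy; apply: (Hd a b f arcf ab).
  have := ler_normD (f a - y) (y - x); rewrite addrA subrK; lra.
exists d => // a b f x arcf Kx fd; rewrite ltNge; apply/negP => ab.
exact: (Hd x Kx a b f arcf ab fd).
Qed.

End Arcs.

(** * Structure of hybrid time domains *)

Section TimeDomains.
Context {R : realType}.
Variable E : set (R * nat).
Hypothesis htdE : hybrid_time_domain E.

(** The last endpoint is [T] because the last interval contains [T] and nothing later. *)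
Lemma htd_partition T J : E (T, J) -> exists tt : nat -> R,
  [/\ tt 0%N = 0, tt J.+1 = T,
      forall i j, (i <= j)%N -> (j <= J.+1)%N -> tt i <= tt j &
      forall t j, (j <= J)%N -> (E (t, j) /\ t <= T <-> tt j <= t <= tt j.+1)].
Proof.
case: htdE => E0 EP ETJ; have [tt [tt0 [ttS Htt]]] := EP T J ETJ.
have mono i j : (i <= j)%N -> (j <= J.+1)%N -> tt i <= tt j.
  elim: j => [|j IH]; first by rewrite leqn0 => /eqP ->.
  rewrite leq_eqVlt => /predU1P[->//|ij] jJ.
  by apply: (le_trans (IH ij (ltnW jJ))); exact: ttS.
have key t j : (j <= J)%N -> (E (t, j) /\ t <= T <-> tt j <= t <= tt j.+1).
  move=> jJ; split.
    move=> [Et tT]; have [] // := (Htt t j).1 _.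
    by split => //; split=> //; rewrite (E0 _ _ Et).
  by move=> tj; have [//|Et [/andP[_ tT] _]] := (Htt t j).2 _.
exists tt; split => //; apply/eqP; rewrite eq_le; apply/andP; split.
  by apply: ((key _ _ (leqnn J)).2 _).2; rewrite lexx ttS.
by have /andP[] : tt J <= T <= tt J.+1 by apply/key.
Qed.

Lemma htd_interval a b j t : E (a, j) -> E (b, j) -> a <= t <= b -> E (t, j).
Proof.
move=> Ea Eb /andP[at' tb]; have [tt [_ ttb _ Htt]] := htd_partition Eb.
have /andP[ja _] := (Htt a j (leqnn j)).1 (conj Ea (le_trans at' tb)).
by apply: ((Htt t j (leqnn j)).2 _).1; rewrite (le_trans ja at') ttb.
Qed.

Lemma htd_next_jump t j T J : E (t, j) -> E (T, J) -> t <= T -> (j < J)%N ->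
  exists2 t', t <= t' <= T & E (t', j) /\ E (t', j.+1).
Proof.
move=> Et ET tT jJ; have [tt [_ ttT mono Htt]] := htd_partition ET.
have /andP[jt tj] := (Htt t j (ltnW jJ)).1 (conj Et tT).
exists (tt j.+1).
  by rewrite tj -ttT mono// ltnW.
split.
  by apply: ((Htt _ j (ltnW jJ)).2 _).1; rewrite lexx (le_trans jt).
by apply: ((Htt _ j.+1 jJ).2 _).1; rewrite lexx mono.
Qed.

Lemma htd_last_jump t j : E (t, j) -> j = 0%N /\ E (0, 0%N) \/
  exists i t0, [/\ j = i.+1, t0 <= t, E (t0, i) & E (t0, i.+1)].
Proof.
move=> Et; have [tt [tt0 ttT mono Htt]] := htd_partition Et.
case: j Et ttT mono Htt => [|i] Et ttT mono Htt.
  left; split=> //; apply: ((Htt _ 0%N (leqnn _)).2 _).1.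
  by rewrite tt0 lexx -tt0 mono.
right; exists i, (tt i.+1); split=> //.
- by rewrite -ttT mono.
- by apply: ((Htt _ i (leqnSn i)).2 _).1; rewrite lexx mono// ltnW.
- by apply: ((Htt _ i.+1 (leqnn _)).2 _).1; rewrite lexx mono.
Qed.

End TimeDomains.

(** * From solutions to flow arcs *)

Section Solutions.
Context {R : realType} {n : nat}.
Local Notation vec := 'rV[R]_n.

Lemma enormN (x : vec) : enorm (- x) = enorm x.
Proof. by rewrite /enorm; congr (Num.sqrt _); apply: eq_bigr => i _; rewrite mxE sqrrN. Qed.

Lemma osc_rel_opp (F : vec -> set vec) S : osc_rel F S -> osc_rel (sv_opp F) S.
Proof.
move=> oF x y xs ys Sx Sxs cx Fy cy; exists (- y); last by rewrite opprK.
apply: (oF x (- y) xs (fun k => - ys k)) => //; last exact: cvgN.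
by move=> i; have [z Fz <-] := Fy i; rewrite opprK.
Qed.

Lemma locbdd_rel_opp (F : vec -> set vec) S : locbdd_rel F S -> locbdd_rel (sv_opp F) S.
Proof.
move=> lF x Sx; have [d [d0 [m Hm]]] := lF x Sx; exists d; split=> //; exists m.
by move=> y _ Sy yx [z Fz <-]; rewrite enormN; exact: Hm yx Fz.
Qed.

Lemma abs_cont_on_continuous (a b : R) (f : R -> vec) t e : abs_cont_on a b f ->
  0 < e -> a <= t <= b ->
  exists2 d : R, 0 < d & forall s, a <= s <= b -> `|s - t| < d -> `|f s - f t| < e.
Proof.
move=> acf e0 /andP[at' tb]; have [d [d0 Hd]] := acf e e0.
have H u v : a <= u -> u <= v -> v <= b -> v - u < d -> `|f v - f u| < e.
  move=> au uv vb uvd; apply: (le_lt_trans (norm_le_enorm _)).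
  have := Hd 1%N (fun=> u) (fun=> v); rewrite !big_ord_recl !big_ord0 !addr0.
  by apply=> // -[|k] [|l].
exists d => // s /andP[as' sb]; rewrite ltr_norml => std.
have [ts|/ltW st] := leP t s; first by apply: H => //; lra.
by rewrite distrC; apply: H => //; lra.
Qed.

Variables (C D : set vec) (F G : vec -> set vec).
Variables (E : set (R * nat)) (phi : R -> nat -> vec).
Hypotheses (clC : closed C) (domF : C `<=` dom_sv F).
Hypothesis solE : is_solution C F D G E phi.

(** The mean value clause is [abs_cont_mean_value]. Membership in [C], granted only in the interior,
    reaches the endpoints by continuity and closedness. *)
Lemma solution_flow_arc a b j : E (a, j) -> E (b, j) -> a <= b ->
  flow_arc C F a b (phi^~ j).
Proof.
move=> Ea Eb; case: solE => [[htdE _] acE _ flowE _].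
have sub t : a <= t <= b -> E (t, j) by exact: htd_interval.
rewrite le_eqVlt => /predU1P[<-|ab].
  split; [|by rewrite ltxx|by move=> c d K ac cd da; lra].
  move=> t at' e e0; exists 1 => // s as' _.
  by rewrite (_ : s = t) ?subrr ?normr0//; lra.
have acf c d : a <= c -> c <= d -> d <= b -> abs_cont_on c d (phi^~ j).
  move=> ac cd db; apply: acE => // t /= /andP[ct td]; apply: sub; lra.
have intE t : a < t < b -> interior (Ij E j) t.
  move=> tab; have := @near_in_itvoo _ a b t; rewrite in_itv /= => /(_ tab).
  apply: filterS => z; rewrite in_itv /= => /andP[az zb].
  by apply: sub; rewrite !ltW.
have [|Cint aeF] := flowE j; first by exists ((a + b) / 2); apply: intE; lra.
have cf t : a <= t <= b -> forall e : R, 0 < e -> exists2 d : R, 0 < d &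
    forall s, a <= s <= b -> `|s - t| < d -> `|phi s j - phi t j| < e.
  by move=> tab e e0; apply: (abs_cont_on_continuous (acf a b _ _ _) e0 tab); lra.
have Cab t : a <= t <= b -> C (phi t j).
  move=> tab; apply: closed_adherent => // e e0.
  have [d d0 Hd] := cf t tab e e0.
  have [s [sab std]] : exists s, a < s < b /\ `|s - t| < d.
    have [tb|bt] := ltP t b.
      pose m := Num.min (b - t) d.
      have m0 : 0 < m by rewrite lt_min d0 subr_gt0 tb.
      have mb : m <= b - t by rewrite ge_min lexx.
      have md : m <= d by rewrite ge_min lexx orbT.
      by exists (t + m / 2); rewrite ltr_norml; lra.
    pose m := Num.min (b - a) d.
    have m0 : 0 < m by rewrite lt_min d0 subr_gt0 ab.
    have mb : m <= b - a by rewrite ge_min lexx.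
    have md : m <= d by rewrite ge_min lexx orbT.
    by exists (b - m / 2); rewrite ltr_norml; lra.
  exists (phi s j); first by apply: Cint; exact: intE.
  by apply: Hd => //; lra.
split=> // c d K ac cd db cvK FK e e0.
have [k0 Fk0] := domF (Cab c ltac:(lra)).
apply: (@abs_cont_mean_value _ _ c d (phi^~ j) K k0) => //.
- exact: acf (ltW cd) _.
- by apply: (FK c) => //; rewrite lexx ltW.
- have [N [mN N0 HN]] := aeF.
  exists N; split => // t /= Ht; apply: HN => /= H; apply: Ht => tcd.
  have [|dt Ft] := H; first by apply: sub; lra.
  by split=> //; exact: FK Ft.
Qed.

Hypotheses (oscF : osc_rel F C) (lbF : locbdd_rel F C).
Hypothesis cvF : forall x, C x -> Defs.convex_set (F x).
Hypothesis FD : forall x, C x -> D x -> F x `&` tangent_cone C x = set0.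

(* [hybrid_time_domain] alone allows a spur, i.e. a jump leaving an interval that
   goes on flowing; it is excluded because flow from D is impossible. *)
Lemma solution_jump_mono t j T J : E (t, j) -> E (T, J) -> t < T -> (j <= J)%N.
Proof.
move=> Et ET tT; rewrite leqNgt; apply/negP => Jj.
have [[htdE _] _ _ _ jumpE] := solE.
have [tt [_ ttT mono Htt]] := htd_partition htdE Et.
(* At [tt J.+1] the solution jumps from index [J], yet this index persists at the later time [T]: an
   arc that starts in [D]. *)
have EJ : E (tt J.+1, J).
  by apply: ((Htt _ J (ltnW Jj)).2 _).1; rewrite lexx mono// ltnW// ltnW.
have EJS : E (tt J.+1, J.+1).
  by apply: ((Htt _ J.+1 Jj).2 _).1; rewrite lexx mono.
have ttt : tt J.+1 <= t by rewrite -ttT mono// ltnW.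
have [Dx _] := jumpE _ _ EJ EJS.
have arc := solution_flow_arc EJ ET (le_trans ttt (ltW tT)).
have eta0 : 0 < T - tt J.+1 by lra.
have [d d0 Hd] := no_long_flow_arc_local clC oscF lbF cvF eta0
  (fun Cx => FD Cx Dx).
by apply: (Hd _ _ _ arc); rewrite ?subrr ?normr0.
Qed.

End Solutions.

(** * The jump map: closed images and uniform continuity *)

Section JumpMap.
Context {R : realType} {n : nat}.
Local Notation vec := 'rV[R]_n.

Lemma compact_closed_separated (K A : set vec) : compact K -> closed A ->
  (forall x, K x -> ~ A x) ->
  exists2 d : R, 0 < d & forall x y, K x -> A y -> d <= `|x - y|.
Proof.
move=> cK clA KA.
pose P (d : R) x := forall y, A y -> d <= `|x - y|.
have [|d d0 Hd] := @compact_uniform _ _ K P cK; last by exists d => // x y Kx; exact: Hd.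
move=> x Kx; have [d d0 Hd] := closed_avoid_ball clA (KA x Kx).
exists (d / 2); first by lra.
move=> z e zx e0 ed y Ay; rewrite leNgt; apply/negP => zy; apply: (Hd y) => //.
rewrite distrC in zy; have := ler_normD (y - z) (z - x); rewrite addrA subrK; lra.
Qed.

Variables (D : set vec) (G : vec -> set vec).
Hypothesis oscG : osc_rel G D.

Lemma closed_sv_image_compact (K : set vec) : compact K -> K `<=` D ->
  closed (sv_image G K).
Proof.
move=> cK KD y cly.
have /choice[p Hp] : forall k, exists p : vec * vec,
    [/\ K p.1, G p.1 p.2 & `|p.2 - y| <= k.+1%:R^-1].
  move=> k; have [|z [[x Kx Gz] +]] := cly (ball y k.+1%:R^-1).
    by apply: nbhsx_ballx; rewrite invr_gt0.
  by rewrite -ball_normE /ball_ /= distrC => /ltW yz; exists (x, z).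
have [r _ Kr] := compact_vec_bounded cK.
have [|s [l [ks sl]]] := @bounded_seq_cluster R n (fun k => (p k).1) r.
  by move=> k; apply: Kr; have [] := Hp k.
have Kl : K l.
  apply: (closed_adherent (compact_closed (@norm_hausdorff _ _) cK)) => e e0.
  have [N _ HN] := near_infty_natSinv_lt (PosNum e0).
  exists (p (s N)).1; first by have [] := Hp (s N).
  by apply: (le_lt_trans (sl N)); apply: HN => /=.
exists l => //.
apply: (oscG (xs := fun k => (p (s k)).1) (ys := fun k => (p (s k)).2)).
- exact: KD.
- by move=> i; apply: KD; have [] := Hp (s i).
- exact: cvg_harmonic_bound.
- by move=> i; have [] := Hp (s i).
- apply: cvg_harmonic_bound => k; have [_ _ /le_trans] := Hp (s k); apply.
  by rewrite lef_pV2 ?posrE// ler_nat ltnS.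
Qed.

Lemma compact_norm_le (r : R) : compact [set x : vec | `|x| <= r].
Proof. by apply: (@compact_vec _ _ _ r) => //; exact: closed_norm_le. Qed.

Hypotheses (clD : closed D) (properG : proper_sv G).

(** Properness localises: values near [y] come from a compact set of jump points. It is cut with [D]
    because [G] may have values elsewhere. *)
Lemma closed_sv_image_proper : closed (sv_image G D).
Proof.
move=> y cly.
have cK : compact (sv_preimage G [set x | `|x| <= `|y| + 1] `&` D).
  by apply: compact_closedI => //; apply: properG; exact: compact_norm_le.
suff : sv_image G (sv_preimage G [set x | `|x| <= `|y| + 1] `&` D) y.
  by move=> [x [_ Dx] Gy]; exists x.
apply: closed_sv_image_compact => //.
move=> B nB; have [|z [[x Dx Gz] [Bz yz]]] := cly (B `&` ball y 1).
  by apply: filterI => //; exact: nbhsx_ballx.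
exists z; split=> //; exists x => //; split=> //; exists z => //=.
move: yz; rewrite -ball_normE /ball_ /= distrC => yz.
have := ler_normD (z - y) y; rewrite subrK; lra.
Qed.

Hypotheses (lbG : locbdd_rel G D) (domG : D `<=` dom_sv G).
Hypothesis svG : single_valued G.

(** Single-valuedness turns upper semicontinuity into continuity, and compactness makes it uniform
    with only one of the two points confined to [K]. *)
Lemma jump_map_unif_continuous (K : set vec) (e : R) : compact K -> K `<=` D ->
  0 < e -> exists2 d : R, 0 < d & forall v x y z, K v -> D x -> G v y -> G x z ->
    `|x - v| < d -> `|z - y| < e.
Proof.
move=> cK KD e0.
pose P (d : R) v := D v -> forall x y z, D x -> G v y -> G x z ->
    `|x - v| < d -> `|z - y| < e.
have [|d d0 Hd] := @compact_uniform _ _ K P cK; last first.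
  by exists d => // v x y z Kv; apply: Hd => //; exact: KD.
move=> v0 /KD Dv0; have [y0 Gy0] := domG Dv0.
have e20 : 0 < e / 2 by lra.
have [d d0 Hd] := osc_locbdd_usc oscG lbG Dv0 e20.
have {}Hd x z : D x -> `|x - v0| < d -> G x z -> `|z - y0| < e / 2.
  by move=> Dx xv Gz; have [w Gw] := Hd x z Dx xv Gz; rewrite (svG Gw Gy0).
exists (d / 2); first by lra.
move=> v d' vv0 d'0 d'd Dv x y z Dx Gy Gz xv.
have H1 : `|y - y0| < e / 2 by apply: (Hd v) => //; lra.
have H2 : `|z - y0| < e / 2.
  by apply: (Hd x) => //; have := ler_normD (x - v) (v - v0); rewrite addrA subrK; lra.
rewrite distrC in H1; have := ler_normD (z - y0) (y0 - y); rewrite addrA subrK; lra.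
Qed.

End JumpMap.

(** * Closeness to A and the compact set of relevant jump points *)

Section Closeness.
Context {R : realType} {n : nat}.
Local Notation vec := 'rV[R]_n.

Lemma rhoA_lt (C D : set vec) (G : vec -> set vec) (x y : vec) (s : R) :
  (rhoA C D G x y < s%:E)%E -> exists u v, [/\ `|x - u| < s, `|y - v| < s &
    u = v \/ (D v /\ G v u) \/ (D u /\ G u v)].
Proof.
move=> /ereal_inf_lt[_ [[u v] [_ _ /= uv] <-]]; rewrite lte_fin => H.
exists u, v; split => //; apply: le_lt_trans H; apply: (le_trans (norm_le_enorm _));
  rewrite -[leLHS]ger0_norm ?sqrtr_ge0// -sqrtr_sqr ler_sqrt ?addr_ge0 ?sqr_ge0//.
  by rewrite lerDl sqr_ge0.
by rewrite lerDr sqr_ge0.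
Qed.

(** A bounded [D] serves itself. For a bounded solution, properness bounds the jump points whose
    image is near it. *)
Lemma relevant_jump_set (D : set vec) (G : vec -> set vec) (E : set (R * nat)) phi :
  closed D -> proper_sv G -> set_bounded D \/ sol_bounded E phi ->
  exists K, [/\ compact K, K `<=` D,
    forall t j x, E (t, j) -> D x -> `|phi t j - x| < 1 -> K x &
    forall t j x y, E (t, j) -> D x -> G x y -> `|phi t j - y| < 1 -> K x].
Proof.
move=> clD pG [[r [_ Dr]]|[r [_ phir]]].
  exists D; split => //; apply: (@compact_vec _ _ _ r) => // x Dx.
  exact: le_trans (norm_le_enorm _) (Dr x Dx).
pose B := [set x : vec | `|x| <= r + 1].
have cB : compact B by exact: compact_norm_le.
have near_B t j y : E (t, j) -> `|phi t j - y| < 1 -> B y.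
  move=> Et; rewrite distrC => ty.
  have := ler_normD (y - phi t j) (phi t j).
  have := le_trans (norm_le_enorm (phi t j)) (phir t j Et).
  by rewrite subrK /B /=; lra.
exists ((B `|` sv_preimage G B) `&` D); split.
- by apply: compact_closedI => //; apply: compactU => //; exact: pG.
- by move=> x [].
- by move=> t j x Et Dx tx; split=> //; left; exact: near_B tx.
- move=> t j x y Et Dx Gxy ty; split=> //; right; exists y => //.
  exact: near_B ty.
Qed.

End Closeness.

(** * Choice of constants and case analysis on nearby pairs of A *)

Theorem theorem1 (R : realType) (n : nat) (C D : set 'rV[R]_n)
  (F G : 'rV[R]_n -> set 'rV[R]_n)
  (Estar : set (R * nat)) (phistar : R -> nat -> 'rV[R]_n) :
  hybrid_basic_conditions C F D G ->
  is_solution C F D G Estar phistar -> t_complete Estar ->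
  (* (i) *)
  sv_image G D `&` D = set0 -> sv_image G D `<=` C ->
  single_valued G -> proper_sv G ->
  (* (ii) *)
  (forall x, C x -> D x -> F x `&` tangent_cone C x = set0) ->
  (* (iii) *)
  (forall x, C x -> sv_image G D x -> sv_opp F x `&` tangent_cone C x = set0) ->
  (* (iv) *)
  set_bounded D \/ sol_bounded Estar phistar ->
  forall eps : R, 0 < eps -> exists s : R, 0 < s /\
    forall (E : set (R * nat)) (phi : R -> nat -> 'rV[R]_n),
      is_solution C F D G E phi -> t_complete E ->
      (* (v) *)
      enorm (phistar 0 0%N - phi 0 0%N) < s ->
      (* (vi) *)
      (forall t j, Estar (t, j) -> exists jt, E (t, jt) /\
         (rhoA C D G (phistar t j) (phi t jt) < s%:E)%E) ->
      forall t j, Estar (t, j) -> exists t' j', E (t', j') /\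
        `|t - t'| < eps /\ enorm (phistar t j - phi t' j') < eps.
Proof.
move=> [[clC clD] [oscF lbF domF cvF] [oscG lbG domG]] solS _ GD0 _ svG pG FD FG bnd.
move=> eps eps0.
have GDN y : sv_image G D y -> ~ D y.
  by move=> Gy Dy; have : (sv_image G D `&` D) y by []; rewrite GD0.
have [KD [cKD KDD KDl KDr]] := relevant_jump_set clD pG bnd.
pose KG := sv_image G KD.
have KGD y : KG y -> sv_image G D y by move=> [x /KDD Dx Gx]; exists x.
have clKG : closed KG by exact: (closed_sv_image_compact oscG).
have [rD rD0 HrD] := compact_vec_bounded cKD.
have [rG rG0 HrG] := compact_image_bounded lbG cKD KDD.
have cKG : compact KG by apply: (compact_vec clKG) => y [x Kx Gx]; exact: HrG Gx.
have [s1 s10 sep1] := compact_closed_separated cKD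
  (closed_sv_image_proper oscG clD pG) (fun x Kx Gx => GDN x Gx (KDD x Kx)).
have [s2 s20 sep2] := compact_closed_separated cKG clD (fun y Ky => GDN y (KGD y Ky)).
pose e1 := eps / n.+1%:R.
have e10 : 0 < e1 by rewrite divr_gt0.
have e1eps (x : 'rV[R]_n) : `|x| < e1 -> enorm x < eps.
  by move=> xe; apply: (le_lt_trans (enorm_le_norm x)); rewrite mulrC -ltr_pdivlMr.
have e120 : 0 < e1 / 2 by lra.
have [dG dG0 contG] := jump_map_unif_continuous oscG lbG domG svG cKD KDD e120.
(* The bound by [e1] closes the final estimates, the one by [dG] lets [contG] apply after a short
   flow, and the other two contradict [sep1] and [sep2]. *)
have [rho [rho0 rho_e1 rho_dG rho_s1 rho_s2]] : exists rho : R,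
    [/\ 0 < rho, 4 * rho <= e1, 2 * rho <= dG, 3 * rho <= s1 & 2 * rho <= s2].
  exists (Num.min (Num.min e1 dG) (Num.min s1 s2) / 4).
  set m := Num.min _ _.
  have m0 : 0 < m by rewrite !lt_min e10 dG0 s10 s20.
  have h1 : m <= e1 by rewrite !ge_min lexx.
  have h2 : m <= dG by rewrite !ge_min lexx !orbT.
  have h3 : m <= s1 by rewrite !ge_min lexx !orbT.
  have h4 : m <= s2 by rewrite !ge_min lexx !orbT.
  by split; lra.
have oscN := osc_rel_opp oscF; have lbN := locbdd_rel_opp lbF.
have cvN x (Cx : C x) : Defs.convex_set (sv_opp F x) := convex_set_opp (cvF x Cx).
(* This radius covers all points within 1 of [KD] or [KG]. *)
have [etaf etaf0 travF] := flow_arc_short_travel clC lbF (rD + rG + 1) rho0.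
have [etab etab0 travB] := flow_arc_short_travel clC lbN (rD + rG + 1) rho0.
have [eta [eta0 eta_eps eta_f eta_b]] : exists eta : R,
    [/\ 0 < eta, eta < eps, eta <= etaf & eta <= etab].
  exists (Num.min (eps / 2) (Num.min etaf etab)).
  set m := Num.min _ _.
  have m0 : 0 < m by rewrite !lt_min etaf0 etab0 divr_gt0.
  have h1 : m <= eps / 2 by rewrite !ge_min lexx.
  by split; [|lra|rewrite !ge_min lexx !orbT|rewrite !ge_min lexx !orbT].
have [df df0 longF] := no_long_flow_arc clC oscF lbF cvF cKD eta0
  (fun x Kx Cx => FD x Cx (KDD x Kx)).
have [db db0 longB] := no_long_flow_arc clC oscN lbN cvN cKG eta0
  (fun y Ky Cy => FG y Cy (KGD y Ky)).
have [s [s0 s_1 s_rho s_df s_db]] : exists s : R,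
    [/\ 0 < s, s <= 1, s <= rho, s <= df & s <= db].
  exists (Num.min (Num.min 1 rho) (Num.min df db)).
  by split; rewrite ?lt_min ?ge_min ?lexx ?orbT ?ltr01 ?rho0 ?df0 ?db0.
exists s; split=> // E phi solE tcE v_init vi t j Et.
have [[htdS _] _ _ _ jumpS] := solS.
have [[htdE E00] _ _ _ jumpE] := solE.
have tri (x y z : 'rV[R]_n) : `|x - z| <= `|x - y| + `|y - z|.
  by rewrite -{1}(subrK y x) -addrA; exact: ler_normD.
have bnd_near (x y : 'rV[R]_n) : `|x - y| < s -> KD y \/ KG y -> `|x| <= rD + rG + 1.
  move=> xy H; have : `|y| <= rD + rG.
    case: H => [/HrD|[z Kz /(HrG _ _ Kz)]]; lra.
  have := ler_normD (x - y) y; rewrite subrK; lra.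
have nearS t1 j1 j2 : Estar (t1, j1) -> (rhoA C D G (phistar t1 j1) (phi t1 j2) < s%:E)%E ->
  exists u v, [/\ `|phistar t1 j1 - u| < s, `|phi t1 j2 - v| < s &
    u = v \/ (KD v /\ G v u) \/ (KD u /\ G u v)].
  move=> Et1 /rhoA_lt[u [v [su sv uv]]]; exists u, v; split=> //.
  case: uv => [->|[[Dv Gv]|[Du Gu]]]; [by left| |].
  - by right; left; split=> //; apply: (KDr _ _ _ _ Et1 Dv Gv); exact: lt_le_trans s_1.
  - by right; right; split=> //; apply: (KDl _ _ _ Et1 Du); exact: lt_le_trans s_1.
have [jt [Ejt /(nearS _ _ _ Et)[u [v [su sv]]]]] := vi t j Et.
case=> [uv|[[Kv Gvu]|[Ku Guv]]].
- exists t, jt; split=> //; split; first by rewrite subrr normr0.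
  apply: e1eps; apply: (le_lt_trans (tri _ u _)).
  by rewrite uv in su *; rewrite distrC in sv; lra.
- (* phi is about to jump to a point near u *)
  have [T [J [ET Tt]]] := tcE (t + eta).
  have tT : t < T by lra.
  have arcL b : E (b, jt) -> t <= b -> b - t < eta.
    move=> Eb tb; have arc := solution_flow_arc clC domF solE Ejt Eb tb.
    by apply: (longF _ _ _ v arc Kv); exact: lt_le_trans s_df.
  have jJ : (jt < J)%N.
    rewrite ltn_neqAle (solution_jump_mono clC domF solE oscF lbF cvF FD Ejt ET tT) andbT.
    apply/eqP => jJ; rewrite -jJ in ET; have := arcL T ET (ltW tT); lra.
  have [t' /andP[tt' _] [E1 E2]] := htd_next_jump htdE Ejt ET (ltW tT) jJ.
  have [Dx Gx] := jumpE _ _ E1 E2.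
  have t'eta := arcL t' E1 tt'.
  have trav : `|phi t' jt - phi t jt| < rho.
    apply: (travF t t' (phi^~ jt) (solution_flow_arc clC domF solE Ejt E1 tt')) => //; first by lra.
    by apply: (bnd_near _ v) => //; left.
  have cG : `|phi t' jt.+1 - u| < e1 / 2.
    apply: (contG v (phi t' jt) u) => //; have := tri (phi t' jt) (phi t jt) v; lra.
  exists t', jt.+1; split=> //; split; first by rewrite ltr_norml; lra.
  apply: e1eps; rewrite distrC in cG.
  have := tri (phistar t j) u (phi t' jt.+1); lra.
have KGv : KG v by exists u.
(* Travel is measured backwards, since it is the endpoint at time [t] that is known to be near
   [u]. *)
have travS t0 : Estar (t0, j) -> t0 <= t -> t - t0 <= eta ->
    `|phistar t0 j - phistar t j| < rho.
  move=> Et0 t0t dt.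
  have := travB _ _ _ (flow_arc_rev (solution_flow_arc clC domF solS Et0 Et t0t)).
  rewrite !opprK; apply; [lra|lra|].
  by apply: (bnd_near _ u) => //; left.
(* Had the arc begun with a jump less than [eta] ago, its start in [G(D)] would be too close to [u]
   in [D], against [sep1]. *)
have [[j0 t_eta]|Et2] : (j = 0%N /\ t <= eta) \/ Estar (t - eta, j).
  have [[j0 E0]|[i [t0 [ji t0t Ei Ei1]]]] := htd_last_jump htdS Et.
    have [te|et] := leP t eta; [by left | right].
    by rewrite -j0 in E0; apply: (htd_interval htdS E0 Et); lra.
  have [Dx Gx] := jumpS _ _ Ei Ei1; rewrite -ji in Ei1 Gx.
  right; apply: (htd_interval htdS Ei1 Et); apply/andP; split; last by lra.
  rewrite leNgt; apply/negP => te.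
  have := travS t0 Ei1 t0t ltac:(lra).
  have := sep1 u (phistar t0 j) Ku ltac:(by exists (phistar t0 i)).
  have := tri u (phistar t j) (phistar t0 j).
  rewrite (distrC u (phistar t j)) (distrC (phistar t j) (phistar t0 j)); lra.
- exists 0, 0%N; split=> //; have t0 : 0 <= t by exact: htdS.1 Et.
  split; first by rewrite subr0 ger0_norm//; lra.
  have ES0 : Estar (0, 0%N) by case: solS => [[]].
  rewrite j0 in Et travS *; apply: e1eps.
  have := travS 0 ES0 t0 ltac:(lra); rewrite distrC.
  have := le_lt_trans (norm_le_enorm _) v_init.
  have := tri (phistar t 0%N) (phistar 0 0%N) (phi 0 0%N); lra.
have trav := travS _ Et2 ltac:(lra) ltac:(lra).
have [j2 [Ej2 /(nearS _ _ _ Et2)[u2 [v2 [su2 sv2]]]]] := vi _ _ Et2.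
case=> [uv2|[[Kv2 Gvu2]|[Ku2 Guv2]]].
- exists (t - eta), j2; split=> //; split; first by rewrite ltr_norml; lra.
  apply: e1eps; rewrite distrC in trav; rewrite uv2 in su2; rewrite distrC in sv2.
  have := tri (phistar t j) (phistar (t - eta) j) (phi (t - eta) j2).
  have := tri (phistar (t - eta) j) v2 (phi (t - eta) j2); lra.
(* Here [u2] lies in [G(D)], yet within [3 * rho] of [u] in [D]. *)
- exfalso.
  have := sep1 u u2 Ku ltac:(by exists v2 => //; exact: KDD).
  have := tri u (phistar t j) u2; have := tri (phistar t j) (phistar (t - eta) j) u2.
  rewrite (distrC u (phistar t j)) (distrC (phistar t j) (phistar (t - eta) j)); lra.
(* Now [phi] is near [KG] at [t - eta] and at [t]. With equal indices, a reversed arc of length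
   [eta] starts near [v]; otherwise a point of [D] is reached too close to [v2]. *)
exfalso.
have j2jt : (j2 < jt)%N.
  have tt2 : t - eta < t by lra.
  rewrite ltn_neqAle (solution_jump_mono clC domF solE oscF lbF cvF FD Ej2 Ejt tt2) andbT.
  apply/eqP => jj; rewrite jj in Ej2.
  have arc := flow_arc_rev (solution_flow_arc clC domF solE Ej2 Ejt (ltW tt2)).
  have := longB _ _ _ v arc KGv; rewrite !opprK => /(_ (lt_le_trans sv s_db)); lra.
have [t' t't [E1 E2]] := htd_next_jump htdE Ej2 Ejt ltac:(lra) j2jt.
have [Dx _] := jumpE _ _ E1 E2.
have KGv2 : KG v2 by exists u2.
have := sep2 v2 _ KGv2 Dx.
have : `|phi t' j2 - phi (t - eta) j2| < rho.
  have tt' : t - eta <= t' by lra.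
  apply: (travF _ _ (phi^~ j2) (solution_flow_arc clC domF solE Ej2 E1 tt')) => //; first by lra.
  by apply: (bnd_near _ v2) => //; right.
have := tri v2 (phi (t - eta) j2) (phi t' j2).
rewrite (distrC v2 (phi (t - eta) j2)) (distrC (phi (t - eta) j2) (phi t' j2)); lra.
Qed.
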